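(* Let $\mathcal{M}$ be a smooth manifold with Riemannian metric $g$, let $\nabla$ be an affine connection on $\mathcal{M}$ and let $\nabla^{\star}$ be its torsion dual. Suppose that $\nabla$ is metric, i.e. $\nabla g=0$, and that the distortion tensor of $\nabla$ is antisymmetric in its last pair of indices, $N_{ijk}=-N_{ikj}$. Then there exists a $3$-form (a totally antisymmetric tensor of rank 3) $A$, $A_{ijk}=A_{[ijk]}$, such that in local coordinates $$\Gamma_{kij}=\Gamma^{(0)}_{kij}+A_{kij},\qquad \Gamma^{\star}_{kij}=\Gamma^{(0)}_{kij}-A_{kij},$$ where $\Gamma_{kij}$, $\Gamma^{\star}_{kij}$ and $\Gamma^{(0)}_{kij}$ are the (lowered) coefficients of $\nabla$, $\nabla^{\star}$ and the Levi-Civita connection of $g$, respectively.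
   Context: All objects are smooth; $\mathfrak{X}(\mathcal{M})$ denotes the smooth vector fields. Connection coefficients are defined by $\nabla_{\partial_i}\partial_j=\Gamma^{k}{}_{ji}\partial_k$ (note the index order), and $\Gamma_{kij}=g_{kl}\Gamma^{l}{}_{ij}$; likewise for other connections. Torsion dual: the torsion dual connection $\nabla^{\star}$ of an affine connection $\nabla$ is the affine connection defined by $\nabla_XY-\nabla^{\star}_YX-[X,Y]=0$ for all $X,Y\in\mathfrak{X}(\mathcal{M})$; in local coordinates, $\Gamma^{\star\, i}{}_{kj}=\Gamma^{i}{}_{jk}$. Distortion: $\nabla^{(0)}$ denotes the Levi-Civita connection of $g$, with coefficients $\Gamma^{(0)m}{}_{ij}$. The distortion tensor $N$ of $\nabla$ is defined by $\Gamma^{m}{}_{ij}=\Gamma^{(0)m}{}_{ij}+N^{m}{}_{ij}$, and $N_{kij}=g_{km}N^{m}{}_{ij}$. Square brackets around indices denote antisymmetrization with normalization $1/p!$ for $p$ indices. *)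

(* Defs.v *)
From HB Require Import structures.
From mathcomp Require Import all_boot all_order all_algebra.
From mathcomp Require Import all_classical all_reals all_analysis.
Set Implicit Arguments.
Unset Strict Implicit.
Unset Printing Implicit Defensive.
Import Order.TTheory GRing.Theory Num.Theory.
Import numFieldNormedType.Exports.
Local Open Scope classical_set_scope.
Local Open Scope ring_scope.

Section SmoothMaps.
Variables (R : realType) (U V : normedModType R).

(* Meant for open D and finite-dimensional U, where continuity of x |-> 'd f x
   amounts to continuity of each x |-> 'D_v f x. *)
Fixpoint Ck_on (k : nat) (D : set U) (f : U -> V) : Prop :=
  if k is k'.+1 then
    (forall x, D x -> differentiable f x) /\ (forall v, Ck_on k' D ('D_v f))
  else forall x, D x -> {for x, continuous f}.

Definition smooth_on (D : set U) (f : U -> V) : Prop := forall k, Ck_on k D f.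

End SmoothMaps.

Section Charts.
Variables (R : realType) (n : nat) (M : topologicalType).

(* A homeomorphism from the open set cdom onto an open subset of R^n; the values
   of cmap outside cdom, and of cinv outside the image of cdom, are junk. *)
Record chart := Chart {
  cdom : set M;
  cmap : M -> 'rV[R]_n;
  cinv : 'rV[R]_n -> M;
  cdom_open : open cdom;
  cimg_open : open (cmap @` cdom);
  cmapK : forall p, cdom p -> cinv (cmap p) = p;
  cmap_continuous : forall p, cdom p -> {for p, continuous cmap};
  cinv_continuous : forall p, cdom p -> {for cmap p, continuous cinv} }.

Definition transition (c d : chart) : 'rV[R]_n -> 'rV[R]_n := cmap d \o cinv c.

Definition compatible (c d : chart) : Prop :=
  smooth_on (cmap c @` (cdom c `&` cdom d)) (transition c d) /\
  smooth_on (cmap d @` (cdom c `&` cdom d)) (transition d c).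

End Charts.

Record smooth_manifold (R : realType) (n : nat) := SmoothManifold {
  carrier :> topologicalType;
  manifold_hausdorff : hausdorff_space carrier;
  manifold_second_countable : @second_countable carrier;
  atlas : set (chart R n carrier);
  atlas_cover : forall p : carrier, exists2 c, atlas c & cdom c p;
  atlas_compatible : forall c d, atlas c -> atlas d -> compatible c d;
  atlas_maximal :
    forall c, (forall d, atlas d -> compatible c d) -> atlas c }.

Section Geometry.
Variables (R : realType) (n : nat) (M : smooth_manifold R n).
Let chartM := chart R n M.

Definition chart_at (p : M) (c : chartM) : Prop := atlas c /\ cdom c p.

(* Row i holds the derivatives of the coordinates of d by the i-th coordinate
   of c. *)
Definition jac (c d : chartM) (p : M) : 'M[R]_n :=
  jacobian (transition c d) (cmap c p).

Definition smooth_in (V : normedModType R) (c : chartM) (f : M -> V) : Prop :=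
  smooth_on (cmap c @` cdom c) (f \o cinv c).

Definition smooth_fun (f : M -> R) : Prop :=
  forall c, atlas c -> smooth_in (V := R^o) c f.

(* A tangent vector at p is given by its components in all the charts at p,
   subject to the contravariant transformation law; components in the other
   charts are set to 0, so that vector fields are equal iff they have the same
   components. *)
Definition field := M -> chartM -> 'rV[R]_n.

Definition fscale (f : M -> R) (X : field) : field := fun p c => f p *: X p c.

Definition tangent (p : M) (v : chartM -> 'rV[R]_n) : Prop :=
  (forall c d, chart_at p c -> chart_at p d -> v d = v c *m jac c d p) /\
  (forall c, ~ chart_at p c -> v c = 0).

Definition vector_field (X : field) : Prop :=
  (forall p, tangent p (X p)) /\
  (forall c, atlas c -> smooth_in c (fun p => X p c)).

(* X f at p, computed in the chart c at p *)
Definition vder (c : chartM) (X : field) (f : M -> R) (p : M) : R :=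
  'D_(X p c) (f \o cinv c : _ -> R^o) (cmap c p).

(* Components of [X, Y] in the chart c *)
Definition bracket (c : chartM) (X Y : field) (p : M) : 'rV[R]_n :=
  'D_(X p c) ((fun q => Y q c) \o cinv c) (cmap c p) -
  'D_(Y p c) ((fun q => X q c) \o cinv c) (cmap c p).

(* conn X Y is the covariant derivative of Y along X; it is unspecified when X
   or Y is not a vector field. *)
Record affine_connection := AffineConnection {
  conn :> field -> field -> field;
  conn_vector_field : forall X Y,
    vector_field X -> vector_field Y -> vector_field (conn X Y);
  conn_linear : forall f X Y Z, smooth_fun f ->
    vector_field X -> vector_field Y -> vector_field Z ->
    conn (fscale f X + Y) Z = fscale f (conn X Z) + conn Y Z;
  conn_additive : forall X Y Z,
    vector_field X -> vector_field Y -> vector_field Z ->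
    conn X (Y + Z) = conn X Y + conn X Z;
  conn_leibniz : forall f X Y, smooth_fun f ->
    vector_field X -> vector_field Y ->
    forall p c, chart_at p c ->
    conn X (fscale f Y) p c = vder c X f p *: Y p c + f p *: conn X Y p c }.

Record riemannian_metric := RiemannianMetric {
  metric :> M -> chartM -> 'M[R]_n;
  metric_covariant : forall p c d, chart_at p c -> chart_at p d ->
    metric p c = jac c d p *m metric p d *m (jac c d p)^T;
  metric_sym : forall p c, chart_at p c -> (metric p c)^T = metric p c;
  metric_pos : forall p c, chart_at p c ->
    forall v : 'rV[R]_n, v != 0 -> 0 < (v *m metric p c *m v^T) 0 0;
  metric_smooth : forall c, atlas c -> forall i j,
    smooth_in (V := R^o) c (fun p => metric p c i j) }.

Definition antisym3 (A : 'I_n -> 'I_n -> 'I_n -> R) (i j k : 'I_n) : R :=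
  (3`!)%:R^-1 *
  (A i j k + A j k i + A k i j - A j i k - A i k j - A k j i).

Record three_form := ThreeForm {
  form :> M -> chartM -> 'I_n -> 'I_n -> 'I_n -> R;
  form_covariant : forall p c d, chart_at p c -> chart_at p d ->
    forall i j k, form p c i j k =
      \sum_a \sum_b \sum_e
        jac c d p i a * jac c d p j b * jac c d p k e * form p d a b e;
  form_antisym : forall p c, chart_at p c ->
    forall i j k, form p c i j k = antisym3 (form p c) i j k;
  form_smooth : forall c, atlas c -> forall i j k,
    smooth_in (V := R^o) c (fun p => form p c i j k) }.

Implicit Types (nabla : affine_connection) (g : riemannian_metric).

Definition inner g (c : chartM) (X Y : field) (p : M) : R :=
  (X p c *m g p c *m (Y p c)^T) 0 0.

(* (nabla_Z g)(X, Y), in the chart c *)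
Definition nabla_metric nabla g (c : chartM) (Z X Y : field) (p : M) : R :=
  vder c Z (inner g c X Y) p
  - inner g c (nabla Z X) Y p - inner g c X (nabla Z Y) p.

Definition metric_connection g nabla : Prop :=
  forall X Y Z, vector_field X -> vector_field Y -> vector_field Z ->
  forall p c, chart_at p c -> nabla_metric nabla g c Z X Y p = 0.

Definition torsion_free nabla : Prop :=
  forall X Y, vector_field X -> vector_field Y ->
  forall p c, chart_at p c ->
  nabla X Y p c - nabla Y X p c - bracket c X Y p = 0.

Definition levi_civita g nabla : Prop :=
  metric_connection g nabla /\ torsion_free nabla.

Definition torsion_dual nabla nabla' : Prop :=
  forall X Y, vector_field X -> vector_field Y ->
  forall p c, chart_at p c ->
  nabla X Y p c - nabla' Y X p c - bracket c X Y p = 0.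

(* A connection acts on global vector fields, so the coordinate field of index
   i of c is replaced near p by a global vector field agreeing with it around
   p. One exists by a cut-off argument, and by locality of connections the
   coefficients below do not depend on its choice. *)
Definition extends_coord (c : chartM) (p : M) (i : 'I_n) : set field :=
  [set X | vector_field X /\ \forall q \near p, X q c = delta_mx 0 i].

Definition coord_field (c : chartM) (p : M) (i : 'I_n) : field :=
  xget 0 (extends_coord c p i).

(* coeff nabla c p k j i is Gamma^k_{ji}, the k-th component of the derivative
   of the j-th coordinate field along the i-th one. *)
Definition coeff nabla (c : chartM) (p : M) (k j i : 'I_n) : R :=
  nabla (coord_field c p i) (coord_field c p j) p c 0 k.

Definition coeff_low g nabla (c : chartM) (p : M) (k i j : 'I_n) : R :=
  \sum_l g p c k l * coeff nabla c p l i j.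

(* nabla0 is meant to be the Levi-Civita connection of g *)
Definition distortion nabla nabla0 (c : chartM) (p : M) (m i j : 'I_n) : R :=
  coeff nabla c p m i j - coeff nabla0 c p m i j.

Definition distortion_low g nabla nabla0 (c : chartM) (p : M)
    (k i j : 'I_n) : R :=
  \sum_m g p c k m * distortion nabla nabla0 c p m i j.

End Geometry.

(* Main.v *)
Require Import Defs.
From HB Require Import structures.
From mathcomp Require Import all_boot all_order all_algebra.
From mathcomp Require Import ring lra.
From mathcomp Require Import all_classical all_reals all_analysis.
Set Implicit Arguments.
Unset Strict Implicit.
Unset Printing Implicit Defensive.
Import Order.TTheory GRing.Theory Num.Theory.
Import numFieldNormedType.Exports.
Local Open Scope classical_set_scope.
Local Open Scope ring_scope.

(** The form A is the lowered distortion N itself. Write T X Y for the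
   difference nabla X Y - nabla0 X Y, so that

     N_{kij} = g(d_k, T d_j d_i)    (distortion_lowE).

   Both connections being metric, the derivatives of g(X, Y) cancel in T and
   g(T Z X, Y) = - g(X, T Z Y) (difference_skew), that is N_{kij} = - N_{ikj}.
   Together with the assumed antisymmetry in the last two indices this makes N
   totally antisymmetric. The formula for the coefficients of nabla is then the
   definition of N. The torsion dual exchanges the two lower indices of the
   coefficients, because coordinate fields have zero bracket
   (coeff_torsion_dual); nabla0, being torsion-free, is its own dual, so that
   exchanging i and j in Gamma_{kij} = Gamma0_{kij} + N_{kij} only changes the
   sign of N.

   The longer part of the proof shows that N is a smooth tensor field, although
   its components are computed with coordinate fields extended to the whole
   manifold by an unspecified choice that varies with the point. The Leibniz
   terms cancel in T, which is therefore linear over functions in both arguments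
   (differenceZl, differenceZr); hence T X Y at p depends only on X and Y at p
   (tensorial, eq_difference). The transformation law of N follows from
   bilinearity at p, and its smoothness from replacing, for all points near p,
   the chosen extensions by the ones chosen at p.

   Passing from linearity over functions to dependence on values at a point, and
   the very existence of extended coordinate fields, both require smooth cut-off
   functions on the manifold (cutoff). They are built from x |-> exp (- 1 / x),
   and their smoothness rests on the closure of C^k functions under sums,
   products, composition and local equality. *)

(** * Functions of class C^k *)

Section CkCalculus.
Variables (R : realType) (U V : normedModType R).

(** The difference of the two functions vanishes near x, hence is differentiable
   with zero differential. *)
Lemma near_differentiable (f g : U -> V) (x : U) :
  {near x, f =1 g} -> differentiable f x -> differentiable g x.
Proof.
move=> fg df.
pose h := g - f.
have h0 : \forall y \near (0 : U), (h \o shift x) y = 0.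
  move: (fg); rewrite (near_shift (0 : U) x); apply: filterS => y /=.
  by rewrite subr0 => fgy; rewrite /h !fctE fgy subrr.
have hx : h x = 0 by have := nbhs_singleton h0; rewrite /= add0r.
have hE : h \o shift x = cst (h x) + (\0 : U -> V) +o_ 0 id.
  rewrite hx; apply/eqaddoP => e e0; near=> y.
  have -> : (h \o shift x - (cst 0 + \0)) y = 0.
    have -> : (h \o shift x - (cst 0 + \0)) y = h (y + x) - (0 + 0) by [].
    by rewrite addr0 subr0; near: y; exact: h0.
  by rewrite normr0 mulr_ge0 // ltW.
have c0 : continuous (\0 : U -> V) by exact: cst_continuous.
have dh : differentiable h x.
  by apply/diff_locallyP; rewrite (diff_unique c0 hE).
have -> : g = f + h by rewrite /h addrC subrK.
exact: differentiableD.
Unshelve. all: by end_near. Qed.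

(** Ck_on quantifies over the points of D at each order, so that local equality
   at the points of D suffices and D need not be open. *)
Lemma Ck_on_near (k : nat) (D : set U) (f g : U -> V) :
  (forall x, D x -> {near x, f =1 g}) -> Ck_on k D f -> Ck_on k D g.
Proof.
elim: k f g => [|k IH] f g fg /= => [cf x Dx|[df Df]].
  have fgx := fg x Dx.
  have fgE : f x = g x := nbhs_singleton fgx.
  rewrite /prop_for /continuous_at -fgE.
  apply: cvg_trans (cf x Dx).
  by apply: near_eq_cvg; apply: filterS fgx => y ->.
split=> [x Dx|v]; first exact: near_differentiable (fg x Dx) (df x Dx).
apply: IH (Df v) => x Dx.
have := fg x Dx; move=> /near_join; apply: filterS => y fgy.
exact: near_eq_derive.
Qed.

Lemma eq_Ck_on (k : nat) (D : set U) (f g : U -> V) :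
  open D -> {in D, f =1 g} -> Ck_on k D f -> Ck_on k D g.
Proof.
move=> oD fg; apply: Ck_on_near => x Dx.
apply: filterS (open_nbhs_nbhs (conj oD Dx)) => y Dy.
by apply: fg; rewrite inE.
Qed.

Lemma Ck_onU (k : nat) (D E : set U) (f : U -> V) :
  Ck_on k D f -> Ck_on k E f -> Ck_on k (D `|` E) f.
Proof.
elim: k f => [|k IH] f /= => [cD cE x [/cD|/cE] //|[dD DD] [dE DE]].
by split=> [x [/dD|/dE] //|v]; exact: IH.
Qed.

Lemma sub_Ck_on (k : nat) (D E : set U) (f : U -> V) :
  D `<=` E -> Ck_on k E f -> Ck_on k D f.
Proof.
move=> DE; elim: k f => [|k IH] f /= => [c x /DE/c //|[dE dvE]].
by split=> [x /DE/dE //|v]; exact: IH.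
Qed.

Lemma Ck_on_bigcup (I : Type) (k : nat) (D : I -> set U) (f : U -> V) :
  (forall i, Ck_on k (D i) f) -> Ck_on k (\bigcup_i D i) f.
Proof.
elim: k f => [|k IH] f /= => [c x [i _ /c] //|c].
split=> [x [i _ /(proj1 (c i))] //|v]; apply: IH => i; exact: (proj2 (c i)).
Qed.

Lemma Ck_onW (k : nat) (D : set U) (f : U -> V) : Ck_on k.+1 D f -> Ck_on k D f.
Proof.
elim: k f => [|k IH] f [df Df]; first by move=> x /df/differentiable_continuous.
by split=> // v; exact: IH (Df v).
Qed.

Lemma Ck_on_cst (k : nat) (D : set U) (w : V) : Ck_on k D (cst w : U -> V).
Proof.
elim: k w => [|k IH] w /= => [x _|]; first exact: cst_continuous.
split=> [x _|v]; first exact: differentiable_cst.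
have -> : 'D_v (cst w : U -> V) = cst 0.
  by apply/funext => x; rewrite derive_cst.
exact: IH.
Qed.

Lemma Ck_onD (k : nat) (D : set U) (f g : U -> V) :
  open D -> Ck_on k D f -> Ck_on k D g -> Ck_on k D (f + g).
Proof.
move=> oD; elim: k f g => [|k IH] f g /= => [cf cg x Dx|[df Df] [dg Dg]].
  exact: continuousD (cf x Dx) (cg x Dx).
split=> [x Dx|v]; first exact: differentiableD (df x Dx) (dg x Dx).
apply: (eq_Ck_on oD _ (IH _ _ (Df v) (Dg v))) => x; rewrite inE => Dx.
by rewrite deriveD //; apply/diff_derivable; [exact: df|exact: dg].
Qed.

Lemma Ck_on_sum (I : Type) (r : seq I) (P : pred I) (k : nat) (D : set U)
    (f : I -> U -> V) :
  open D -> (forall i, Ck_on k D (f i)) -> Ck_on k D (\sum_(i <- r | P i) f i).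
Proof.
move=> oD cf; elim/big_rec: _ => [|i g _ cg]; first exact: (Ck_on_cst _ _ 0).
exact: Ck_onD.
Qed.

End CkCalculus.

Lemma Ck_on_linear (R : realType) (U V W : normedModType R) (k : nat)
    (D : set U) (f : U -> V) (L : {linear V -> W}) :
  open D -> continuous L -> Ck_on k D f -> Ck_on k D (L \o f).
Proof.
move=> oD cL; elim: k f => [|k IH] f /= => [cf x Dx|[df Df]].
  by apply: continuous_comp; [exact: cf|exact: cL].
have dL y : differentiable L y by exact: linear_differentiable.
split=> [x Dx|v]; first by apply: differentiable_comp; [exact: df|].
apply: (eq_Ck_on oD _ (IH _ (Df v))) => x; rewrite inE => Dx.
have dfx := df _ Dx.
rewrite [RHS]deriveE; last exact: differentiable_comp.
by rewrite diff_comp //= diff_lin // deriveE.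
Qed.

Lemma Ck_on_scalel (R : realType) (U V : normedModType R) (k : nat)
    (D : set U) (f : U -> R^o) (w : V) :
  open D -> Ck_on k D f -> Ck_on k D (fun x => f x *: w).
Proof.
have lin : linear (fun a : R^o => a *: w).
  by move=> a x y; rewrite scalerDl scalerA.
pose L : {linear R^o -> V} :=
  HB.pack (fun a : R^o => a *: w) (GRing.isLinear.Build _ _ _ _ _ lin).
move=> oD; apply: (@Ck_on_linear _ _ _ _ k D f L oD).
exact: scalel_continuous.
Qed.

Lemma Ck_on_coord (R : realType) (U : normedModType R) (n k : nat)
    (D : set U) (f : U -> 'rV[R]_n) (j : 'I_n) :
  open D -> Ck_on k D f -> Ck_on k D (fun x => f x 0 j : R^o).
Proof.
have lin : linear (fun v : 'rV[R]_n => v 0 j : R^o) by move=> a x y; rewrite !mxE.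
pose L : {linear 'rV[R]_n -> R^o} :=
  HB.pack (fun v : 'rV[R]_n => v 0 j : R^o)
    (GRing.isLinear.Build _ _ _ _ _ lin).
move=> oD; apply: (@Ck_on_linear _ _ _ _ k D f L oD).
exact: coord_continuous.
Qed.

Lemma Ck_on_row (R : realType) (U : normedModType R) (n k : nat)
    (D : set U) (f : U -> 'rV[R]_n) :
  open D -> (forall j, Ck_on k D (fun x => f x 0 j : R^o)) -> Ck_on k D f.
Proof.
move=> oD cf.
have -> : f = \sum_j (fun x => f x 0 j *: delta_mx 0 j).
  by apply/funext => x; rewrite fct_sumE [LHS]row_sum_delta.
by apply: Ck_on_sum => // j; exact: Ck_on_scalel.
Qed.

Lemma Ck_onM (R : realType) (U : normedModType R) (k : nat) (D : set U)
    (f g : U -> R^o) :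
  open D -> Ck_on k D f -> Ck_on k D g -> Ck_on k D (f * g).
Proof.
move=> oD; elim: k f g => [|k IH] f g => [cf cg x Dx|cf cg].
  exact: continuousM (cf x Dx) (cg x Dx).
have [[df Df] [dg Dg]] := (cf, cg).
split=> [x Dx|v]; first exact: differentiableM (df x Dx) (dg x Dx).
apply: (eq_Ck_on oD _ (Ck_onD oD (IH _ _ (Ck_onW cf) (Dg v))
   (IH _ _ (Ck_onW cg) (Df v)))) => x; rewrite inE => Dx.
by rewrite deriveM //; apply/diff_derivable; [exact: df|exact: dg].
Qed.

Lemma Ck_on_scale (R : realType) (U : normedModType R) (n k : nat) (D : set U)
    (f : U -> R^o) (g : U -> 'rV[R]_n) :
  open D -> Ck_on k D f -> Ck_on k D g -> Ck_on k D (fun x => f x *: g x).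
Proof.
move=> oD cf cg; apply: Ck_on_row => // j.
have -> : (fun x => (f x *: g x) 0 j : R^o) = f * (fun x => g x 0 j).
  by apply/funext => x; rewrite mxE.
by apply: Ck_onM => //; exact: Ck_on_coord.
Qed.

Lemma derive_comp (R : realType) (U V W : normedModType R) (f : U -> V)
    (g : V -> W) (x v : U) :
  differentiable f x -> differentiable g (f x) ->
  'D_v (g \o f) x = 'D_('D_v f x) g (f x).
Proof.
move=> df dg; rewrite deriveE; last exact: differentiable_comp.
by rewrite diff_comp //= -(deriveE _ df) -(deriveE _ dg).
Qed.

(** By the chain rule a directional derivative of f \o g is a sum of products
   of derivatives of g with partial derivatives of f taken at g, to which the
   induction on the order of differentiability applies. *)
Lemma Ck_on_comp (R : realType) (U : normedModType R) (n k : nat) (D : set U)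
    (E : set 'rV[R]_n) (f : 'rV[R]_n -> R^o) (g : U -> 'rV[R]_n) :
  open D -> g @` D `<=` E -> Ck_on k E f -> Ck_on k D g -> Ck_on k D (f \o g).
Proof.
move=> oD gDE; elim: k f => [|k IH] f => [cf cg x Dx|cf cg].
  by apply: continuous_comp; [exact: cg|apply: cf; apply: gDE; exists x].
have [[df Df] [dg Dg]] := (cf, cg).
have dfg x (Dx : D x) : differentiable f (g x) by apply: df; apply: gDE; exists x.
split=> [x Dx|v]; first by apply: differentiable_comp; [exact: dg|exact: dfg].
have cv : Ck_on k D (\sum_i ((fun x => 'D_v g x 0 i : R^o)
    * ('D_(delta_mx 0 i) f \o g))).
  apply: Ck_on_sum => // i; apply: Ck_onM => //.
    exact: Ck_on_coord (Dg v).
  exact: IH (Df _) (Ck_onW cg).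
apply: (eq_Ck_on oD _ cv) => x; rewrite inE => Dx.
have [dgx dfgx] := (dg x Dx, dfg x Dx).
rewrite derive_comp // (deriveE _ dfgx) [in RHS](row_sum_delta ('D_v g x)).
rewrite fct_sumE linear_sum; apply: eq_bigr => i _.
by rewrite linearZ /= fctE /= (deriveE _ dfgx).
Qed.

Lemma Ck_on_comp_row (R : realType) (U : normedModType R) (n m k : nat)
    (D : set U) (E : set 'rV[R]_n) (f : 'rV[R]_n -> 'rV[R]_m)
    (g : U -> 'rV[R]_n) :
  open D -> open E -> g @` D `<=` E ->
  Ck_on k E f -> Ck_on k D g -> Ck_on k D (f \o g).
Proof.
move=> oD oE gDE cf cg; apply: Ck_on_row => // j.
exact: (Ck_on_comp oD gDE (Ck_on_coord j oE cf) cg).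
Qed.

(** * A flat function and bump functions *)

Section Flat.
Variable R : realType.

(** All the derivatives of exp (- 1 / x) are combinations of the functions
   flat m, the linear span of which is closed under differentiation
   (is_derive_flat). *)
Definition flat (m : nat) (x : R) : R :=
  if 0 < x then (x^-1) ^+ m * expR (- x^-1) else 0.

Lemma flat_le0 m (x : R) : x <= 0 -> flat m x = 0.
Proof. by rewrite /flat ltNge => ->. Qed.

Lemma flat_gt0 m (x : R) : 0 < x -> 0 < flat m x.
Proof. by move=> x0; rewrite /flat x0 mulr_gt0 ?exprn_gt0 ?invr_gt0 ?expR_gt0. Qed.

(** From exp t >= t^(m+2) / (m+2)! at t = 1 / x. The square gives differentiability
   at 0 with zero derivative. *)
Lemma flat_bound m (x : R) : `|flat m x| <= (m.+2)`!%:R * x ^+ 2.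
Proof.
have [x0|x0] := leP x 0.
  by rewrite flat_le0 // normr0 mulr_ge0 // sqr_ge0.
rewrite gtr0_norm ?flat_gt0 // /flat x0 expRN.
have t0 : 0 < x^-1 by rewrite invr_gt0.
rewrite ler_pdivrMr ?expR_gt0 //.
have := expR_ge1Dxn m.+1 (ltW t0).
have f0 : 0 < (m.+2)`!%:R :> R by rewrite ltr0n fact_gt0.
set e := expR _ => le_e.
have {}le_e : x^-1 ^+ m.+2 / (m.+2)`!%:R <= e by apply: le_trans le_e; rewrite lerDr.
rewrite ler_pdivrMr // in le_e.
rewrite -mulrA mulrC -mulrA (_ : x^-1 ^+ m = x ^+ 2 * x^-1 ^+ m.+2).
  by rewrite ler_pM2l ?exprn_gt0.
by rewrite !exprS; field; rewrite lt0r_neq0.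
Qed.

Lemma is_derive_flat m (x : R) :
  is_derive x 1 (flat m : R -> R) (flat m.+2 x - m%:R * flat m.+1 x).
Proof.
have [x0|x0|->] := ltgtP x 0.
- rewrite !flat_le0 ?(ltW x0) // mulr0 subr0.
  apply: near_eq_is_derive (is_derive_cst (0 : R) x 1).
  near=> y; rewrite flat_le0 //; apply: ltW; near: y; exact: lt_nbhsl.
- pose F : R -> R := fun y => (y^-1) ^+ m * expR (- y^-1).
  have FE : {near x, F =1 flat m}.
    near=> y; have y0 : 0 < y by near: y; exact: lt_nbhsr.
    by rewrite /flat y0.
  apply: near_eq_is_derive FE _.
  have x_neq0 : x != 0 by rewrite gt_eqF.
  have dV : is_derive x 1 (fun y : R => y^-1) (- x ^- 2).
    have := @is_deriveV R id x 1 1 x_neq0 (is_derive_id x 1).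
    by move=> d; apply: is_derive_eq d _; rewrite scaler1.
  have dX := is_deriveX m dV.
  have dE := @is_derive1_comp R expR _ _ _ _ (is_derive_expR _) (is_deriveN dV).
  have -> : F = (fun y : R => y^-1) ^+ m * (expR \o (- (fun y : R => y^-1))).
    by apply/funext => y; rewrite /F !fctE.
  apply: is_derive_eq.
  rewrite /flat x0 !fctE /=.
  rewrite -exprVn; set t := x^-1; set e := expR (- t).
  case: (m) => [|i]; rewrite /= /GRing.scale /= !exprS; ring.
- rewrite !flat_le0 // mulr0 subr0.
  have lim0 : h^-1 *: (flat m (h *: (1 : R) + 0) - flat m 0) @[h --> 0^'] --> (0 : R).
    rewrite (flat_le0 _ (lexx 0)).
    apply/cvgr0Pnorm_le => e e0; near=> h.
    have h0 : h != 0 by near: h; exact: nbhs_dnbhs_neq.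
    rewrite subr0 addr0 [h *: 1]mulr1 normrZ normfV.
    rewrite ler_pdivrMl ?normr_gt0 //.
    apply: (le_trans (flat_bound m _)).
    rewrite -[h ^+ 2]ger0_norm ?sqr_ge0 // normrX expr2 mulrCA ler_wpM2l //.
    rewrite mulrC -ler_pdivlMr ?ltr0n ?fact_gt0 //.
    near: h; apply: nbhs_dnbhs; apply: (@nbhs0_le _ R^o).
    by rewrite divr_gt0 // ltr0n fact_gt0.
  apply: DeriveDef; first by apply/cvg_ex; exists 0.
  exact/cvg_lim.
Unshelve. all: by end_near. Qed.

Lemma Ck_on_flat (U : normedModType R) (k m : nat) (D : set U) (f : U -> R^o) :
  open D -> Ck_on k D f -> Ck_on k D (flat m \o f : U -> R^o).
Proof.
have dflat i y : differentiable (flat i : R^o -> R^o) y.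
  by apply/derivable1_diffP; have [] := is_derive_flat i y.
move=> oD; elim: k m f => [|k IH] m f => [cf x Dx|cf].
  by apply: continuous_comp; [exact: cf|exact: differentiable_continuous].
have [df Df] := cf.
split=> [x Dx|v]; first by apply: differentiable_comp; [exact: df|].
have cfW := Ck_onW cf.
have cv : Ck_on k D (('D_v f : U -> R^o) *
    ((flat m.+2 \o f : U -> R^o) +
      (cst (- m%:R) : U -> R^o) * (flat m.+1 \o f : U -> R^o))).
  apply: (Ck_onM oD (Df v)); apply: (Ck_onD oD (IH _ _ cfW)).
  exact: (Ck_onM oD (Ck_on_cst _ _ _) (IH _ _ cfW)).
apply: (eq_Ck_on oD _ cv) => x; rewrite inE => Dx.
rewrite derive_comp //; last exact: df.
rewrite [RHS]deriveE // -[X in 'd _ _ X]mulr1 [RHS]linearZ /= -deriveE //.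
have [_ ->] := is_derive_flat m (f x).
by rewrite !fctE /= mulNr.
Qed.

(** The function x |-> flat 0 (r^2 - |x - a|^2) is positive exactly on the
   Euclidean ball; comparing it with half of its value at the centre and
   applying flat once more makes it constant near a. *)
Lemma bump_rV (n : nat) (a : 'rV[R]_n) (r : R) : 0 < r ->
  exists phi : 'rV[R]_n -> R^o,
    [/\ smooth_on setT phi, {near a, phi =1 cst 1} &
      forall x : 'rV[R]_n, (exists i, r < `|x 0 i - a 0 i|) -> phi x = 0].
Proof.
move=> r0.
pose c i : 'rV[R]_n -> R^o := (fun x : 'rV[R]_n => x 0 i) + cst (- a 0 i).
pose v : 'rV[R]_n -> R^o := cst (r ^+ 2) + cst (-1) * \sum_i (c i * c i).
pose u : 'rV[R]_n -> R^o := flat 0 \o v.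
have vE (x : 'rV[R]_n) : v x = r ^+ 2 - \sum_i (x 0 i - a 0 i) ^+ 2.
  by rewrite /v !fctE fct_sumE mulN1r.
have oT : open (@setT 'rV[R]_n) by apply: openT.
have cid k : Ck_on k setT (@id 'rV[R]_n).
  case: k => [|k]; first by move=> x _; exact: cvg_id.
  split=> // w.
  apply: (eq_Ck_on oT _ (Ck_on_cst _ _ w)) => x _.
  by rewrite derive_id.
have cv k : Ck_on k setT v.
  apply: (Ck_onD oT (Ck_on_cst _ _ _)); apply: (Ck_onM oT (Ck_on_cst _ _ _)).
  apply: (Ck_on_sum _ _ oT) => i.
  have ci : Ck_on k setT (c i).
    exact: (Ck_onD oT (Ck_on_coord i oT (cid k)) (Ck_on_cst _ _ _)).
  exact: Ck_onM.
have cu k : Ck_on k setT u by exact: Ck_on_flat.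
have ua : 0 < u a.
  apply: flat_gt0; rewrite vE big1 ?subr0 ?exprn_gt0 // => i _.
  by rewrite subrr expr0n.
(* b is half of the value of u at the centre: u exceeds b near a, and u = 0
   off the box. *)
pose b := u a / 2.
have b0 : 0 < b by rewrite divr_gt0.
have Fb : flat 0 b != 0 by rewrite gt_eqF // flat_gt0.
pose phi : 'rV[R]_n -> R^o := cst 1 +
  cst (- (flat 0 b)^-1) * (flat 0 \o (cst b + cst (-1) * u)).
have phiE (x : 'rV[R]_n) : phi x = 1 - (flat 0 b)^-1 * flat 0 (b - u x).
  by rewrite /phi !fctE /= mulN1r mulNr.
exists phi; split=> [k||x [i ri]].
- apply: (Ck_onD oT (Ck_on_cst _ _ _)); apply: (Ck_onM oT (Ck_on_cst _ _ _)).
  apply: (@Ck_on_flat _ k 0 setT (cst b + cst (-1) * u) oT).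
  apply: (Ck_onD oT (Ck_on_cst _ _ _)).
  exact: (Ck_onM oT (Ck_on_cst _ _ _) (cu k)).
- have bu : b < u a by rewrite /b ltr_pdivrMr // mulr_natr mulr2n ltrDl.
  have : \forall x \near a, b < u x.
    exact: (cu 0%N a I _ (lt_nbhsr bu)).
  apply: filterS => x bx; rewrite phiE (_ : flat 0 (b - u x) = 0) ?mulr0 ?subr0 //.
  by rewrite flat_le0 // subr_le0 ltW.
- have ux : u x = 0.
    apply: flat_le0; rewrite vE subr_le0 (bigD1 i) //=.
    rewrite -[(_ - _) ^+ 2]ger0_norm ?sqr_ge0 // normrX.
    rewrite -[leLHS]addr0 lerD ?sumr_ge0 // => [|j _]; last exact: sqr_ge0.
    by rewrite ler_sqr ?nnegrE ?normr_ge0 ?ltW.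
  by rewrite phiE ux subr0 mulVf // subrr.
Qed.

End Flat.

(** * Charts, cut-off functions and extension of vector fields *)

Section ChartTopology.
Variables (R : realType) (n : nat) (M : topologicalType).
Implicit Types (c d : chart R n M) (W : set M) (p q : M).

Lemma open_chart_image c W : open W -> open (cmap c @` (cdom c `&` W)).
Proof.
move=> oW; rewrite openE => _ [q [cq Wq] <-]; rewrite /interior.
have qimg : nbhs (cmap c q) (cmap c @` cdom c).
  by apply: open_nbhs_nbhs; split; [exact: cimg_open|exists q].
have qW : nbhs (cmap c q) (cinv c @^-1` W).
  apply: (cinv_continuous cq); rewrite cmapK //.
  exact: open_nbhs_nbhs.
apply: filterS2 qimg qW => _ [q' cq' <-] /=; rewrite cmapK // => Wq'.
by exists q'.
Qed.

Lemma near_cinv c p (P : set M) :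
  cdom c p -> (\forall q \near p, P q) -> \forall y \near cmap c p, P (cinv c y).
Proof. by move=> cp nP; apply: (cinv_continuous cp); rewrite cmapK. Qed.

Lemma near_cdom c p : cdom c p -> \forall q \near p, cdom c q.
Proof. by move=> cp; apply: open_nbhs_nbhs; split=> //; exact: cdom_open. Qed.

End ChartTopology.

Section ManifoldCalculus.
Variables (R : realType) (n : nat) (M : smooth_manifold R n).
Let chartM := chart R n M.
Implicit Types (c d e : chartM) (p q : M) (X Y : field M).

Lemma transition_smooth c d : atlas c -> atlas d ->
  smooth_on (cmap c @` (cdom c `&` cdom d)) (transition c d).
Proof. by move=> ac ad; have [] := atlas_compatible ac ad. Qed.

Lemma transition_image c d :
  transition c d @` (cmap c @` (cdom c `&` cdom d)) `<=`
  cmap d @` (cdom d `&` cdom c).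
Proof.
by move=> _ [_ [q [cq dq] <-] <-]; exists q; rewrite // /transition /= cmapK.
Qed.

Lemma smooth_on_transition c d (h : 'rV[R]_n -> R^o) (E : set 'rV[R]_n) :
  atlas c -> atlas d -> cmap c @` (cdom c `&` cdom d) `<=` E -> smooth_on E h ->
  smooth_on (cmap d @` (cdom d `&` cdom c)) (h \o transition d c).
Proof.
move=> ac ad sE sh k; apply: (Ck_on_comp _ _ (sh k)).
- by apply: open_chart_image; exact: cdom_open.
- exact: subset_trans (@transition_image d c) sE.
- exact: transition_smooth.
Qed.

(** This is how objects supported in the domain of one chart c, extended by zero,
   are seen to be smooth on the whole manifold. *)
Lemma smooth_in_glue (V : normedModType R) c d (W : set M) (f : M -> V) :
  open W -> (forall q, cdom c q \/ W q) -> (forall q, W q -> f q = 0) ->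
  smooth_on (cmap d @` (cdom d `&` cdom c)) (f \o cinv d) -> smooth_in d f.
Proof.
move=> oW cW f0 sf k.
have -> : cmap d @` cdom d =
    (cmap d @` (cdom d `&` cdom c)) `|` (cmap d @` (cdom d `&` W)).
  rewrite -image_setU -setIUr; congr (_ @` _).
  by rewrite (_ : _ `|` _ = setT) ?setIT // -subTset => q _; exact: cW.
apply: Ck_onU; first exact: sf.
apply: (eq_Ck_on (open_chart_image oW) _ (Ck_on_cst _ _ 0)) => y.
by rewrite inE => -[q [dq Wq] <-] /=; rewrite cmapK // f0.
Qed.

(** A bump function in the chart is extended by zero. Compactness is what
   makes the extension smooth: the image in the manifold of a compact box is
   closed because the manifold is Hausdorff, so its complement W
   is open and, with the chart domain, covers the manifold. *)
Lemma cutoff c p : atlas c -> cdom c p ->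
  exists (chi : M -> R) (W : set M),
    [/\ smooth_fun chi, \forall q \near p, chi q = 1, open W,
        forall q, cdom c q \/ W q & forall q, W q -> chi q = 0].
Proof.
move=> ac cp; pose a := cmap c p.
have /nbhs_ballP[r /= r0 ballE] : nbhs a (cmap c @` cdom c).
  by apply: open_nbhs_nbhs; split; [exact: cimg_open|exists p].
have r20 : 0 < r / 2 by rewrite divr_gt0.
have [phi [sphi phi1 phi0]] := bump_rV a r20.
(* The box has half-width r / 2 so that, although closed, it stays in the ball of
   radius r. *)
pose box := [set y : 'rV[R]_n | forall i, [set` `[a 0 i - r / 2, a 0 i + r / 2]] (y ord0 i)].
have cbox : compact box.
  apply: (@rV_compact R n (fun i => [set` `[a 0 i - r / 2, a 0 i + r / 2]])) => i.
  exact: segment_compact.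
have boxE y : box y -> (cmap c @` cdom c) y.
  move=> yb; apply: ballE; split=> // i j; rewrite ord1 /ball /= /ball_.
  have := yb j; rewrite /= in_itv /= => /andP[y1 y2].
  rewrite (@le_lt_trans _ _ (r / 2)) //; last by lra.
  by rewrite ler_norml; apply/andP; split; lra.
have boxP (y : 'rV[R]_n) : ~ box y -> exists i, r / 2 < `|y 0 i - a 0 i|.
  move=> /existsNP[i /= yi]; exists i; rewrite ltNge; apply/negP => le.
  apply: yi; rewrite in_itv /=; move: le; rewrite ler_norml => /andP[y1 y2].
  by apply/andP; split; lra.
pose K := cinv c @` box.
have cK : closed K.
  apply: (compact_closed (@manifold_hausdorff _ _ M)).
  apply: continuous_compact => //; apply: continuous_in_subspaceT => y.
  rewrite inE => /boxE[q cq <-]; exact: cinv_continuous.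
pose chi q := if `[< cdom c q >] then phi (cmap c q) else 0.
have chiE q : cdom c q -> chi q = phi (cmap c q) by rewrite /chi => /asboolT ->.
have oW : open (~` K) by exact: closed_openC.
have cW q : cdom c q \/ (~` K) q.
  have [[y yb <-]|nK] := pselect (K q); last by right.
  by left; have [q' cq' <-] := boxE _ yb; rewrite cmapK.
have chi0 q : (~` K) q -> chi q = 0.
  move=> nK; rewrite /chi; case: asboolP => // cq.
  by apply: phi0; apply: boxP => yb; apply: nK; exists (cmap c q); rewrite // cmapK.
exists chi, (~` K); split=> //.
- move=> d ad; apply: (smooth_in_glue oW cW chi0) => k.
  have sT := smooth_on_transition ac ad (@subsetT _ _) sphi.
  apply: (eq_Ck_on _ _ (sT k)).
    by apply: open_chart_image; exact: cdom_open.
  move=> y; rewrite inE => -[q [dq cq] <-].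
  by rewrite /= /transition /= cmapK // chiE.
- have := cmap_continuous cp phi1; rewrite nbhs_simpl /= => n1.
  by near=> q; rewrite chiE; [near: q|near: q; exact: near_cdom].
Unshelve. all: by end_near. Qed.

Section Jacobian.
Variable p : M.

Lemma differentiable_transition c d : chart_at p c -> chart_at p d ->
  differentiable (transition c d) (cmap c p).
Proof.
move=> [ac cp] [ad dp]; have [dT _] := transition_smooth ac ad 1%N.
by apply: dT; exists p.
Qed.

Lemma mulmx_jac c d (v : 'rV[R]_n) : chart_at p c -> chart_at p d ->
  v *m jac c d p = 'D_v (transition c d) (cmap c p).
Proof. by move=> cc cd; rewrite deriveEjacobian //; exact: differentiable_transition. Qed.

(** The chain rule, as transition c e is transition d e \o transition c d near p. *)
Lemma jacM c d e : chart_at p c -> chart_at p d -> chart_at p e ->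
  jac c d p *m jac d e p = jac c e p.
Proof.
move=> cc cd ce; apply/row_matrixP => i; rewrite !rowE mulmxA.
apply: (etrans (congr1 (mulmx^~ (jac d e p)) (mulmx_jac _ cc cd))).
apply: (etrans (mulmx_jac _ cd ce)); apply: (etrans _ (esym (mulmx_jac _ cc ce))).
have [dcd dde] := (differentiable_transition cc cd, differentiable_transition cd ce).
have Tp : transition c d (cmap c p) = cmap d p.
  by rewrite /transition /= cmapK //; case: cc.
have -> : 'D_(delta_mx 0 i) (transition c e) (cmap c p) =
    'D_(delta_mx 0 i) (transition d e \o transition c d) (cmap c p).
  apply: near_eq_derive.
  have := near_cinv cc.2 (near_cdom cd.2); apply: filterS => y dy.
  by rewrite /transition /= cmapK.
rewrite -Tp in dde *.
exact: esym (derive_comp _ dcd dde).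
Qed.

Lemma jac_id c : chart_at p c -> jac c c p = 1%:M.
Proof.
move=> cc; apply/row_matrixP => i; rewrite !rowE (mulmx_jac _ cc cc) mulmx1.
rewrite -[RHS](derive_id (cmap c p)); apply: near_eq_derive.
have : nbhs (cmap c p) (cmap c @` cdom c).
  by case: cc => _ cp; apply: open_nbhs_nbhs; split; [exact: cimg_open|exists p].
by apply: filterS => _ [q cq <-]; rewrite /transition /= cmapK.
Qed.

End Jacobian.

(** For a cut-off chi of the chart c this is a global field, equal to the field with
   constant components w in c wherever chi = 1. *)
Definition constant_field c (chi : M -> R) (w : 'rV[R]_n) : field M :=
  fun q d => if `[< chart_at q d /\ cdom c q >]
             then chi q *: (w *m jac c d q) else 0.

Lemma constant_field_vector c chi (W : set M) w : atlas c -> smooth_fun chi ->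
  open W -> (forall q, cdom c q \/ W q) -> (forall q, W q -> chi q = 0) ->
  vector_field (constant_field c chi w).
Proof.
move=> ac schi oW cW chi0; split=> [q|d ad].
  split=> [d e dq eq|d ndq]; rewrite /constant_field.
    case: asboolP => [[_ cq]|neq]; case: asboolP => [[_ cq']|ndq] //.
    - by rewrite -scalemxAl -mulmxA jacM //.
    - by case: ndq.
    - by case: neq.
    - by rewrite mul0mx.
  by case: asboolP => // -[].
apply: (smooth_in_glue oW cW) => [q Wq|k].
  by rewrite /constant_field; case: asboolP => // _; rewrite chi0 // scale0r.
have oD : open (cmap d @` (cdom d `&` cdom c)).
  by apply: open_chart_image; exact: cdom_open.
have oD' : open (cmap c @` (cdom c `&` cdom d)).
  by apply: open_chart_image; exact: cdom_open.
have cchi : Ck_on k (cmap d @` (cdom d `&` cdom c)) (chi \o cinv d : _ -> R^o).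
  by apply: sub_Ck_on (schi d ad k) => _ [q [dq _] <-]; exists q.
have cjac : Ck_on k (cmap d @` (cdom d `&` cdom c))
    ('D_w (transition c d) \o transition d c).
  apply: (Ck_on_comp_row oD oD' (@transition_image d c)).
    by have [_ dT] := transition_smooth ac ad k.+1; exact: dT.
  exact: transition_smooth.
apply: (eq_Ck_on oD _ (Ck_on_scale oD cchi cjac)) => y.
rewrite inE => -[q [dq cq] <-].
rewrite /constant_field /= cmapK //.
case: asboolP => [_|[]//]; congr (_ *: _).
have [cc cd] : chart_at q c /\ chart_at q d by [].
by apply: (etrans _ (esym (mulmx_jac w cc cd))); rewrite /transition /= cmapK.
Qed.

Lemma constant_fieldE c chi w q : atlas c -> cdom c q ->
  constant_field c chi w q c = chi q *: w.
Proof.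
move=> ac cq; rewrite /constant_field; case: asboolP => [_|[]//].
by rewrite jac_id // mulmx1.
Qed.

Lemma exists_extends_coord c p i : chart_at p c -> extends_coord c p i !=set0.
Proof.
move=> [ac cp]; have [chi [W [schi chi1 oW cW chi0]]] := cutoff ac cp.
exists (constant_field c chi (delta_mx 0 i)); split.
  exact: constant_field_vector oW cW chi0.
near=> q; rewrite constant_fieldE //; last by near: q; exact: near_cdom.
rewrite (_ : chi q = 1) ?scale1r //; near: q; exact: chi1.
Unshelve. all: by end_near. Qed.

Lemma coord_fieldP c p i : chart_at p c -> extends_coord c p i (coord_field c p i).
Proof. by move=> cp; apply: xgetPex; exact: exists_extends_coord. Qed.

Lemma coord_field_vector c p i : chart_at p c -> vector_field (coord_field c p i).
Proof. by move=> /(coord_fieldP i)[]. Qed.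

Lemma coord_fieldE c p i : chart_at p c -> coord_field c p i p c = delta_mx 0 i.
Proof. by move=> /(coord_fieldP i)[_ /nbhs_singleton]. Qed.

Lemma vector_field0 : vector_field (0 : field M).
Proof.
split=> [p|c ac k]; last exact: (Ck_on_cst _ _ 0).
by split=> // c d _ _; rewrite mul0mx.
Qed.

Lemma vector_fieldD X Y : vector_field X -> vector_field Y -> vector_field (X + Y).
Proof.
move=> [tX sX] [tY sY]; split=> [p|c ac k].
  have [[X1 X2] [Y1 Y2]] := (tX p, tY p).
  split=> [c d cc cd|c nc]; rewrite !fctE.
    by rewrite (X1 c d) ?(Y1 c d) // mulmxDl.
  by rewrite X2 // Y2 // addr0.
exact: (Ck_onD (@cimg_open _ _ _ c) (sX c ac k) (sY c ac k)).
Qed.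

Lemma vector_fieldZ f X : smooth_fun f -> vector_field X -> vector_field (fscale f X).
Proof.
move=> sf [tX sX]; split=> [p|c ac k].
  have [X1 X2] := tX p; rewrite /fscale.
  split=> [c d cc cd|c nc]; first by rewrite (X1 c d) // scalemxAl.
  by rewrite X2 // scaler0.
exact: (Ck_on_scale (@cimg_open _ _ _ c) (sf c ac k) (sX c ac k)).
Qed.

Lemma smooth_fun_cst (a : R) : smooth_fun (fun _ : M => a).
Proof. by move=> c ac k; exact: (Ck_on_cst _ _ a). Qed.

Lemma vector_fieldB X Y : vector_field X -> vector_field Y -> vector_field (X - Y).
Proof.
move=> vX vY.
have -> : X - Y = X + fscale (fun=> -1) Y.
  by apply/funext => p; apply/funext => c; rewrite !fctE /fscale scaleN1r.
by apply: vector_fieldD => //; apply: vector_fieldZ => //; exact: smooth_fun_cst.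
Qed.

(** These are the coefficients of X in the cut-off coordinate frame of c. Off the
   domain of c they vanish, components in c being 0 there by convention. *)
Lemma smooth_component c chi (W : set M) X i : atlas c -> smooth_fun chi ->
  open W -> (forall q, cdom c q \/ W q) -> (forall q, W q -> chi q = 0) ->
  vector_field X -> smooth_fun (fun q => chi q * X q c 0 i).
Proof.
move=> ac schi oW cW chi0 [tX sX] d ad.
apply: (smooth_in_glue (V := R^o) oW cW) => [q Wq|k]; first by rewrite chi0 // mul0r.
have oD : open (cmap d @` (cdom d `&` cdom c)).
  by apply: open_chart_image; exact: cdom_open.
have cchi : Ck_on k (cmap d @` (cdom d `&` cdom c)) (chi \o cinv d : _ -> R^o).
  by apply: sub_Ck_on (schi d ad k) => _ [q [dq _] <-]; exists q.
have sXi : smooth_on (cmap c @` cdom c) (fun y => X (cinv c y) c 0 i : R^o).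
  by move=> j; exact: (Ck_on_coord i (@cimg_open _ _ _ c) (sX c ac j)).
have sub : cmap c @` (cdom c `&` cdom d) `<=` cmap c @` cdom c.
  by move=> _ [q [cq _] <-]; exists q.
have cX := smooth_on_transition ac ad sub sXi.
apply: (eq_Ck_on oD _ (Ck_onM oD cchi (cX k))) => y.
rewrite inE => -[q [dq cq] <-].
by rewrite !fctE /transition /= !cmapK.
Qed.

End ManifoldCalculus.

(** * The difference of two connections is a tensor *)

Section Difference.
Variables (R : realType) (n : nat) (M : smooth_manifold R n).
Variables (nabla nabla0 : affine_connection M).
Let chartM := chart R n M.
Implicit Types (c d : chartM) (p q : M) (X Y Z : field M).

Definition difference X Y : field M := nabla X Y - nabla0 X Y.

Lemma differenceE X Y p c : difference X Y p c = nabla X Y p c - nabla0 X Y p c.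
Proof. by []. Qed.

Lemma difference_vector X Y :
  vector_field X -> vector_field Y -> vector_field (difference X Y).
Proof. by move=> vX vY; apply: vector_fieldB; exact: conn_vector_field. Qed.

Lemma fscale1 X : fscale (fun=> 1) X = X.
Proof. by apply/funext => p; apply/funext => c; rewrite /fscale scale1r. Qed.

Lemma fscaleB f X Y : fscale f (X - Y) = fscale f X - fscale f Y.
Proof. by apply/funext => p; apply/funext => c; rewrite /fscale !fctE scalerBr. Qed.

Lemma difference_linear_l f X Y Z : smooth_fun f ->
  vector_field X -> vector_field Y -> vector_field Z ->
  difference (fscale f X + Y) Z = fscale f (difference X Z) + difference Y Z.
Proof.
move=> sf vX vY vZ; rewrite /difference !conn_linear // fscaleB.
by rewrite opprD addrACA.
Qed.

Lemma differenceDl X Y Z : vector_field X -> vector_field Y -> vector_field Z ->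
  difference (X + Y) Z = difference X Z + difference Y Z.
Proof.
move=> vX vY vZ.
have := difference_linear_l (@smooth_fun_cst R n M 1) vX vY vZ.
by rewrite !fscale1.
Qed.

Lemma difference0l Z : vector_field Z -> difference 0 Z = 0.
Proof.
move=> vZ; have := differenceDl (@vector_field0 R n M) (@vector_field0 R n M) vZ.
by rewrite addr0 => /eqP; rewrite addrC -subr_eq subrr => /eqP.
Qed.

Lemma differenceZl f X Z : smooth_fun f -> vector_field X -> vector_field Z ->
  difference (fscale f X) Z = fscale f (difference X Z).
Proof.
move=> sf vX vZ; have := difference_linear_l sf vX (@vector_field0 R n M) vZ.
by rewrite addr0 difference0l // addr0.
Qed.

Lemma differenceDr X Y Z : vector_field X -> vector_field Y -> vector_field Z ->
  difference X (Y + Z) = difference X Y + difference X Z.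
Proof.
by move=> vX vY vZ; rewrite /difference !conn_additive // opprD addrACA.
Qed.

Lemma difference0r X : vector_field X -> difference X 0 = 0.
Proof.
move=> vX; have := differenceDr vX (@vector_field0 R n M) (@vector_field0 R n M).
by rewrite addr0 => /eqP; rewrite addrC -subr_eq subrr => /eqP.
Qed.

(** The derivative terms of the two Leibniz rules cancel: unlike a connection,
   the difference of two connections is linear over functions in its second
   argument. *)
Lemma differenceZr f X Y p c : smooth_fun f -> vector_field X -> vector_field Y ->
  chart_at p c -> difference X (fscale f Y) p c = f p *: difference X Y p c.
Proof.
move=> sf vX vY cp; rewrite !differenceE !(conn_leibniz _ sf) //.
by rewrite opprD addrACA subrr add0r scalerBr.
Qed.

Section AtPoint.
Variables (p : M) (c : chartM).
Hypothesis cp : chart_at p c.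

(** Linearity over smooth functions, asked of the components in c at p only. *)
Definition function_linear (L : field M -> field M) :=
  [/\ L 0 p c = 0,
      forall X Y, vector_field X -> vector_field Y ->
        L (X + Y) p c = L X p c + L Y p c &
      forall f X, smooth_fun f -> vector_field X ->
        L (fscale f X) p c = f p *: L X p c].

(** With chi a cut-off equal to 1 at p and supported in the domain of c, the
   global identity chi^2 X = \sum_i (chi X^i) (chi d_i) expresses X by global
   fields wherever chi = 1, so that an operator linear over functions sees only the
   components of X at p. *)
Lemma tensorial (L : field M -> field M) (X : field M) (F : 'I_n -> field M) :
  function_linear L -> vector_field X ->
  (forall i, vector_field (F i)) -> (forall i, F i p c = delta_mx 0 i) ->
  L X p c = \sum_i X p c 0 i *: L (F i) p c.
Proof.
move=> [L0 LD LZ] vX vF FE; have [ac cp'] := cp.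
have [chi [W [schi chi1 oW cW chi0]]] := cutoff ac cp'.
have chip : chi p = 1 by exact: nbhs_singleton chi1.
pose E i := constant_field c chi (delta_mx 0 i).
have vE i : vector_field (E i) by exact: constant_field_vector oW cW chi0.
have Lsum (I : finType) (G : I -> field M) : (forall i, vector_field (G i)) ->
    L (\sum_i G i) p c = \sum_i L (G i) p c.
  move=> vG; suff [] : vector_field (\sum_i G i) /\
    L (\sum_i G i) p c = \sum_i L (G i) p c by [].
  apply: (big_ind2 (fun Y w => vector_field Y /\ L Y p c = w)) => //.
    by split; [exact: vector_field0|].
  move=> Y1 w1 Y2 w2 [v1 <-] [v2 <-]; split; first exact: vector_fieldD.
  exact: LD.
have LE Y : vector_field Y -> L Y p c = \sum_i Y p c 0 i *: L (E i) p c.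
  move=> vY; pose f i q := chi q * Y q c 0 i.
  have sf i : smooth_fun (f i) by exact: smooth_component oW cW chi0 vY.
  have YE : fscale chi (fscale chi Y) = \sum_i fscale (f i) (E i).
    apply/funext => q; apply/funext => d; rewrite !fct_sumE /fscale /f /E.
    rewrite /constant_field; have [Y1 Y2] := vY.1 q.
    have [[dq cq]|nq] := pselect (chart_at q d /\ cdom c q).
      rewrite (asboolT (conj dq cq)) (Y1 c d) // [in LHS](row_sum_delta (Y q c)).
      rewrite mulmx_suml !scaler_sumr; apply: eq_bigr => i _.
      by rewrite -scalemxAl !scalerA mulrAC.
    rewrite (asboolF nq) big1 => [|i _]; last by rewrite scaler0.
    have [dq|ndq] := pselect (chart_at q d); last by rewrite Y2 // !scaler0.
    (* q is outside the domain of c, where chi vanishes *)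
    by have [cq|/chi0 ->] := cW q; [case: nq|rewrite scale0r].
  have := congr1 (fun Z => L Z p c) YE.
  rewrite LZ //; last exact: vector_fieldZ.
  rewrite LZ // chip !scale1r Lsum => [->|i]; last exact: vector_fieldZ.
  by apply: eq_bigr => i _; rewrite LZ // /f chip mul1r.
rewrite LE //; apply: eq_bigr => i _; rewrite [in RHS]LE // FE.
rewrite (bigD1 i) //= big1 ?addr0 => [|j ji].
  by rewrite mxE !eqxx scale1r.
by rewrite mxE (negbTE ji) andbF scale0r.
Qed.

Lemma difference_suml X Y (F : 'I_n -> field M) : vector_field X -> vector_field Y ->
  (forall i, vector_field (F i)) -> (forall i, F i p c = delta_mx 0 i) ->
  difference X Y p c = \sum_i X p c 0 i *: difference (F i) Y p c.
Proof.
move=> vX vY; apply: (tensorial (L := difference^~ Y)) => //; split.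
- by rewrite difference0l.
- by move=> X1 X2 v1 v2; rewrite differenceDl.
- by move=> f X1 sf v1; rewrite differenceZl.
Qed.

Lemma difference_sumr X Y (F : 'I_n -> field M) : vector_field X -> vector_field Y ->
  (forall i, vector_field (F i)) -> (forall i, F i p c = delta_mx 0 i) ->
  difference X Y p c = \sum_i Y p c 0 i *: difference X (F i) p c.
Proof.
move=> vX vY; apply: tensorial => //; split.
- by rewrite difference0r.
- by move=> Y1 Y2 v1 v2; rewrite differenceDr.
- by move=> f Y1 sf v1; rewrite differenceZr.
Qed.

Lemma difference_coord X Y : vector_field X -> vector_field Y ->
  difference X Y p c = \sum_i \sum_j
    (X p c 0 i * Y p c 0 j) *:
      difference (coord_field c p i) (coord_field c p j) p c.
Proof.
have vC i := coord_field_vector i cp; have CE i := coord_fieldE i cp.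
move=> vX vY; rewrite (difference_suml vX vY vC CE); apply: eq_bigr => i _.
rewrite (difference_sumr (vC i) vY vC CE) scaler_sumr; apply: eq_bigr => j _.
by rewrite scalerA.
Qed.

Lemma eq_difference X X' Y Y' :
  vector_field X -> vector_field Y -> vector_field X' -> vector_field Y' ->
  X p c = X' p c -> Y p c = Y' p c -> difference X Y p c = difference X' Y' p c.
Proof.
by move=> vX vY vX' vY' XE YE; rewrite !difference_coord // XE YE.
Qed.

End AtPoint.
End Difference.

(** * The distortion as a 3-form *)

Lemma antisym3_id (R : realType) (n : nat) (A : 'I_n -> 'I_n -> 'I_n -> R)
    (i j k : 'I_n) :
  (forall i j k, A i j k = - A j i k) ->
  (forall i j k, A i j k = - A i k j) ->
  A i j k = antisym3 A i j k.
Proof.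
move=> A12 A23; rewrite /antisym3.
have -> : A j k i = A i j k by rewrite A23 A12 opprK.
have -> : A k i j = A i j k by rewrite A12 A23 opprK.
have -> : A k j i = - A i j k by rewrite A12 A23 A12 opprK.
rewrite (A12 j i k) (A23 i k j) !opprK.
by rewrite (_ : (3`!)%:R = 6 :> R) //; field.
Qed.

Section Distortion.
Variables (R : realType) (n : nat) (M : smooth_manifold R n).
Variables (g : riemannian_metric M) (nabla nabla0 : affine_connection M).
Let chartM := chart R n M.
Implicit Types (c d : chartM) (p q : M) (X Y Z : field M).
Local Notation T := (difference nabla nabla0).

Lemma inner_chart c d p X Y : chart_at p c -> chart_at p d ->
  vector_field X -> vector_field Y -> inner g c X Y p = inner g d X Y p.
Proof.
move=> cc cd [/(_ p)[Xt _] _] [/(_ p)[Yt _] _]; rewrite /inner.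
rewrite (metric_covariant g cc cd) (Xt c d) // (Yt c d) // trmx_mul.
by rewrite !mulmxA.
Qed.

Lemma innerC c p X Y : chart_at p c -> inner g c X Y p = inner g c Y X p.
Proof.
move=> cp; rewrite /inner -[in RHS](Defs.metric_sym g cp) -[in RHS](trmxK (Y p c)).
by rewrite -mulmxA -!trmx_mul [RHS]mxE.
Qed.

Lemma innerBr c p X Y Z :
  inner g c X (Y - Z) p = inner g c X Y p - inner g c X Z p.
Proof. by rewrite /inner !fctE linearB /= mulmxBr !mxE. Qed.

Lemma innerBl c p X Y Z :
  inner g c (X - Y) Z p = inner g c X Z p - inner g c Y Z p.
Proof. by rewrite /inner !fctE !mulmxBl !mxE. Qed.

Lemma innerE c p X Y :
  inner g c X Y p = \sum_i \sum_j X p c 0 i * g p c i j * Y p c 0 j.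
Proof.
rewrite /inner -mulmxA mxE; apply: eq_bigr => i _.
rewrite mxE mulr_sumr; apply: eq_bigr => j _; by rewrite mxE mulrA.
Qed.

Lemma smooth_inner c X Y : atlas c -> vector_field X -> vector_field Y ->
  smooth_in (V := R^o) c (inner g c X Y).
Proof.
move=> ac [_ /(_ c ac) sX] [_ /(_ c ac) sY] k.
have oD := @cimg_open _ _ _ c.
have -> : (inner g c X Y \o cinv c : _ -> R^o) = \sum_i \sum_j
    ((fun y => X (cinv c y) c 0 i) * (fun y => g (cinv c y) c i j)) *
      (fun y => Y (cinv c y) c 0 j).
  apply/funext => y; rewrite /= innerE fct_sumE; apply: eq_bigr => i _.
  by rewrite fct_sumE; apply: eq_bigr.
apply: (Ck_on_sum _ _ oD) => i; apply: (Ck_on_sum _ _ oD) => j.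
apply: (Ck_onM oD); last exact: (Ck_on_coord j oD (sY k)).
apply: (Ck_onM oD); first exact: (Ck_on_coord i oD (sX k)).
exact: metric_smooth.
Qed.

Lemma distortion_low_sum c p (k i j : 'I_n) :
  distortion_low g nabla nabla0 c p k i j =
  \sum_m g p c k m * T (coord_field c p j) (coord_field c p i) p c 0 m.
Proof. by apply: eq_bigr => m _; rewrite /distortion /coeff !mxE. Qed.

Lemma distortion_lowE c p (k i j : 'I_n) : chart_at p c ->
  distortion_low g nabla nabla0 c p k i j =
  inner g c (coord_field c p k) (T (coord_field c p j) (coord_field c p i)) p.
Proof.
move=> cp; rewrite distortion_low_sum /inner coord_fieldE // -rowE [RHS]mxE.
by apply: eq_bigr => m _; rewrite [row _ _ _ _]mxE [_^T _ _]mxE.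
Qed.

(** The derivative of g(X, Y) along Z is common to the two compatibility conditions
   and cancels in their difference. *)
Lemma difference_skew c p X Y Z :
  metric_connection g nabla -> metric_connection g nabla0 ->
  vector_field X -> vector_field Y -> vector_field Z -> chart_at p c ->
  inner g c (T Z X) Y p = - inner g c X (T Z Y) p.
Proof.
move=> m m0 vX vY vZ cp.
have := m X Y Z vX vY vZ p c cp; have := m0 X Y Z vX vY vZ p c cp.
rewrite /nabla_metric /difference innerBl innerBr; lra.
Qed.

Lemma distortion_low_skew c p (k i j : 'I_n) :
  metric_connection g nabla -> metric_connection g nabla0 -> chart_at p c ->
  distortion_low g nabla nabla0 c p k i j =
  - distortion_low g nabla nabla0 c p i k j.
Proof.
move=> m m0 cp; rewrite !distortion_lowE // innerC //.
by apply: difference_skew => //; exact: coord_field_vector.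
Qed.

(** The right-hand side of distortion_lowE makes sense in any chart; compute it in d,
   where the coordinate fields of c have the rows of the Jacobian as components. *)
Lemma distortion_low_covariant c d p (i j k : 'I_n) :
  chart_at p c -> chart_at p d ->
  distortion_low g nabla nabla0 c p i j k =
  \sum_a \sum_b \sum_e
    jac c d p i a * jac c d p j b * jac c d p k e *
      distortion_low g nabla nabla0 d p a b e.
Proof.
move=> cc cd; rewrite distortion_lowE //.
have vC l := coord_field_vector l cc; have vD l := coord_field_vector l cd.
have CE l : coord_field c p l p d = row l (jac c d p).
  by have [/(_ p)[Ct _] _] := vC l; rewrite (Ct c d) // coord_fieldE // rowE.
have vT := difference_vector nabla nabla0 (vC k) (vC j).
have RE l e : row l (jac c d p) 0 e = jac c d p l e by rewrite mxE.
have ZE (z : R) (u : 'rV[R]_n) e : (z *: u) 0 e = z * u 0 e by rewrite mxE.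
rewrite (inner_chart cc cd (vC i) vT) innerE; apply: eq_bigr => a _.
rewrite (difference_coord nabla nabla0 cd (vC k) (vC j)) !CE RE.
under [RHS]eq_bigr => b _ do under eq_bigr => e _ do
  rewrite distortion_low_sum mulr_sumr.
under [LHS]eq_bigr => m _ do rewrite summxE mulr_sumr.
rewrite [LHS]exchange_big [RHS]exchange_big; apply: eq_bigr => e _ /=.
under [LHS]eq_bigr => m _ do rewrite summxE mulr_sumr.
rewrite [LHS]exchange_big; apply: eq_bigr => b _ /=; apply: eq_bigr => m _.
by rewrite ZE !RE; ring.
Qed.

(** Near a given p the component at q is computed with extensions chosen at q, but
   the ones chosen at p have the same values at q, hence give the same component.
   Smoothness is thus checked one point at a time. *)
Lemma distortion_low_smooth c (i j k : 'I_n) : atlas c ->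
  smooth_in (V := R^o) c (fun p => distortion_low g nabla nabla0 c p i j k).
Proof.
move=> ac K.
have -> : cmap c @` cdom c = \bigcup_(p : {p | cdom c p}) [set cmap c (sval p)].
  apply/seteqP; split=> [_ [p cp <-]|_ [[p cp] _ ->]]; last by exists p.
  by exists (exist _ p cp).
apply: Ck_on_bigcup => -[p cp] /=; have cc : chart_at p c by [].
have vC l := coord_field_vector l cc.
have vT := difference_vector nabla nabla0 (vC k) (vC j).
have sI := smooth_inner ac (vC i) vT.
apply: (@Ck_on_near _ _ _ K _ (inner g c (coord_field c p i)
    (T (coord_field c p k) (coord_field c p j)) \o cinv c)); last first.
  by apply: sub_Ck_on (sI K) => _ ->; exists p.
move=> _ ->.
have nCl l : \forall y \near cmap c p,
    coord_field c p l (cinv c y) c = delta_mx 0 l.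
  by have [_ nX] := coord_fieldP l cc; exact: (near_cinv cp nX).
have nC := filter_forall _ nCl.
near=> y; have cy : chart_at (cinv c y) c.
  by split=> //; near: y; exact: (near_cinv cp (near_cdom cp)).
rewrite /= distortion_lowE // /inner.
have vCy l := coord_field_vector l cy.
have E l : coord_field c p l (cinv c y) c = coord_field c (cinv c y) l (cinv c y) c.
  by rewrite coord_fieldE //; move: l; near: y; exact: nC.
rewrite E.
by rewrite (eq_difference _ _ cy (vC k) (vC j) (vCy k) (vCy j) (E k) (E j)).
Unshelve. all: by end_near. Qed.

Hypotheses (m0 : metric_connection g nabla0) (m : metric_connection g nabla).
Hypothesis skew : forall (p : M) c, chart_at p c -> forall i j k : 'I_n,
  distortion_low g nabla nabla0 c p i j k
  = - distortion_low g nabla nabla0 c p i k j.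

Definition distortion_form : three_form M :=
  ThreeForm (fun p c d cc cd i j k => distortion_low_covariant i j k cc cd)
    (fun p c cp i j k => antisym3_id i j k
      (fun i j k => distortion_low_skew i j k m m0 cp) (skew cp))
    (fun c ac i j k => distortion_low_smooth i j k ac).

End Distortion.

(** * Coefficients of the torsion dual *)

Section Coefficients.
Variables (R : realType) (n : nat) (M : smooth_manifold R n).
Implicit Types (nabla : affine_connection M) (c : chart R n M) (p : M).

(** In the chart c both fields have constant components near p. *)
Lemma bracket_coord c p (i j : 'I_n) : chart_at p c ->
  bracket c (coord_field c p i) (coord_field c p j) p = 0.
Proof.
move=> cp; rewrite /bracket.
have D0 l v : 'D_v ((fun q => coord_field c p l q c) \o cinv c) (cmap c p) = 0.
  rewrite -(derive_cst (delta_mx 0 l : 'rV[R]_n) (cmap c p) v).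
  have [_ nX] := coord_fieldP l cp.
  by apply: near_eq_derive; exact: (near_cinv cp.2 nX).
by rewrite !D0 subrr.
Qed.

(** The symmetry of lower indices of a torsion-free connection is the case
   nabla' = nabla. *)
Lemma coeff_torsion_dual nabla nabla' c p (k i j : 'I_n) :
  torsion_dual nabla nabla' -> chart_at p c ->
  coeff nabla' c p k i j = coeff nabla c p k j i.
Proof.
move=> td cp; have vC l := coord_field_vector l cp.
have := td _ _ (vC i) (vC j) p c cp.
rewrite bracket_coord // subr0 => /subr0_eq E.
by rewrite /coeff E.
Qed.

Lemma coeff_low_torsion_dual g nabla nabla' c p (k i j : 'I_n) :
  torsion_dual nabla nabla' -> chart_at p c ->
  coeff_low g nabla' c p k i j = coeff_low g nabla c p k j i.
Proof.
move=> td cp; apply: eq_bigr => l _.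
by rewrite (coeff_torsion_dual _ _ _ td cp).
Qed.

Lemma coeff_lowE g nabla nabla0 c p (k i j : 'I_n) :
  coeff_low g nabla c p k i j =
  coeff_low g nabla0 c p k i j + distortion_low g nabla nabla0 c p k i j.
Proof.
rewrite -big_split; apply: eq_bigr => l _.
by rewrite /distortion /= mulrBr addrC subrK.
Qed.

End Coefficients.

Theorem theorem1 (R : realType) (n : nat) (M : smooth_manifold R n)
    (g : riemannian_metric M) (nabla nabla_star nabla0 : affine_connection M) :
  levi_civita g nabla0 ->
  torsion_dual nabla nabla_star ->
  metric_connection g nabla ->
  (forall (p : M) (c : chart R n M), chart_at p c -> forall i j k : 'I_n,
     distortion_low g nabla nabla0 c p i j k
     = - distortion_low g nabla nabla0 c p i k j) ->
  exists A : three_form M,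
    forall (p : M) (c : chart R n M), chart_at p c -> forall k i j : 'I_n,
      coeff_low g nabla c p k i j = coeff_low g nabla0 c p k i j + A p c k i j
      /\ coeff_low g nabla_star c p k i j
         = coeff_low g nabla0 c p k i j - A p c k i j.
Proof.
move=> [m0 tf0] td m skew; exists (distortion_form m0 m skew) => p c cp k i j /=.
split; first exact: coeff_lowE.
rewrite (coeff_low_torsion_dual _ _ _ _ td cp) (coeff_lowE _ _ nabla0) (skew p c cp).
by rewrite (coeff_low_torsion_dual _ _ _ _ tf0 cp).
Qed.
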